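(* Let $p$ be a prime with $p\equiv 3\pmod 4$ or $p\equiv 5\pmod{12}$. Let $K=\mathbb{Q}_p(\gamma)$, where $\gamma=\iota$ is a root of $x^2+1$ when $p\equiv 3\pmod 4$, and $\gamma=\omega$ is a root of $x^2+x+1$ when $p\equiv 5\pmod{12}$. Consider the continued fraction algorithm on $K$ whose partial quotients are elements of the form $b_0+b_1\gamma$ with $b_0,b_1\in\mathbb{Z}\left[\frac1p\right]\cap\left(-\frac p2,\frac p2\right)$. Then every $\alpha\in\mathbb{Q}(\gamma)$ has a finite continued fraction expansion.
   Context: Each $b\in\mathbb{Q}_p$ is written uniquely as $b=\sum_{j\ge n_0}a_jp^j$ with $a_j\in\{-\frac{p-1}{2},\dots,0,\dots,\frac{p-1}{2}\}$, and $\lfloor b\rfloor_p=\sum_{n_0\le j\le 0}a_jp^j$ (which is $0$ if $|b|_p<1$). Every $\alpha\in K$ is uniquely $\alpha=b_0+b_1\gamma$ with $b_0,b_1\in\mathbb{Q}_p$, and $\lfloor\alpha\rfloor=\lfloor b_0\rfloor_p+\lfloor b_1\rfloor_p\gamma$. The continued fraction expansion of $\alpha\in K$ is generated by $\alpha_0=\alpha$, $c_n=\lfloor\alpha_n\rfloor$, $\alpha_{n+1}=(\alpha_n-\lfloor\alpha_n\rfloor)^{-1}$, where the process stops at step $n$ if $\alpha_n=\lfloor\alpha_n\rfloor$. The expansion is finite if the process stops, i.e. $\alpha_n=\lfloor\alpha_n\rfloor$ for some $n\ge 0$. *)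

(* Defs.v *)
From HB Require Import structures.
From mathcomp Require Import all_boot all_order all_algebra all_field.
From mathcomp Require Import boolp classical_sets functions.
From mathcomp Require Import zify ring lra.

Set Implicit Arguments.
Unset Strict Implicit.
Unset Printing Implicit Defensive.

Import Order.TTheory GRing.Theory Num.Theory.
Local Open Scope ring_scope.
Local Open Scope quotient_scope.

Section RatNorm.
Variables (p : nat) (p_pr : prime p).

Definition rat_val (x : rat) : int :=
  (logn p `|numq x|%N)%:Z - (logn p `|denq x|%N)%:Z.

Definition rat_norm (x : rat) : rat :=
  if x == 0 then 0 else p%:R ^ (- rat_val x).

Let p_gt0 : 0 < p%:R :> rat.
Proof. by rewrite ltr0n prime_gt0. Qed.

Lemma rat_val_frac (a b : int) : a != 0 -> b != 0 ->
  rat_val (a%:~R / b%:~R) = (logn p `|a|%N)%:Z - (logn p `|b|%N)%:Z.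
Proof.
move=> a0 b0; set x := _ / _.
have bq0 : b%:~R != 0 :> rat by rewrite intr_eq0.
have x0 : x != 0 by rewrite mulf_neq0 ?invr_eq0 // intr_eq0.
have xE : a * denq x = numq x * b.
  apply/(@intr_inj rat); rewrite !rmorphM /= numqE /x.
  by rewrite mulrAC mulrVK ?unitfE.
have := congr1 (fun z => logn p `|z|%N) xE.
rewrite !abszM !lognM ?absz_gt0 ?numq_eq0 ?denq_neq0 // => /(congr1 Posz).
by rewrite /rat_val !PoszD; lia.
Qed.

Lemma rat_norm_ge0 x : 0 <= rat_norm x.
Proof. by rewrite /rat_norm; case: eqP => // _; rewrite exprz_ge0 // ltW. Qed.

Lemma rat_norm0 : rat_norm 0 = 0.
Proof. by rewrite /rat_norm eqxx. Qed.

Lemma rat_norm_eq0 x : (rat_norm x == 0) = (x == 0).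
Proof.
rewrite /rat_norm; case: (boolP (x == 0)) => [_|x0]; first exact/eqxx.
by apply/negbTE/expfz_neq0; rewrite lt0r_neq0.
Qed.

Lemma rat_normM x y : rat_norm (x * y) = rat_norm x * rat_norm y.
Proof.
rewrite /rat_norm mulf_eq0.
case: (boolP (x == 0)) => x0 /=; first by rewrite mul0r.
case: (boolP (y == 0)) => y0 /=; first by rewrite mulr0.
rewrite -expfzDr ?lt0r_neq0 // -opprD; congr (_ ^ - _).
have xyE : x * y = (numq x * numq y)%:~R / (denq x * denq y)%:~R.
  by rewrite -{1}(divq_num_den x) -{1}(divq_num_den y) mulf_div !rmorphM.
rewrite xyE rat_val_frac ?mulf_neq0 ?numq_eq0 ?denq_neq0 //.
rewrite !abszM !lognM ?absz_gt0 ?numq_eq0 ?denq_neq0 //.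
by rewrite !PoszD /rat_val opprD addrACA.
Qed.

Lemma rat_norm1 : rat_norm 1 = 1.
Proof. by rewrite /rat_norm oner_eq0 /rat_val /= !logn1 subrr oppr0 expr0z. Qed.

Lemma rat_normN x : rat_norm (- x) = rat_norm x.
Proof. by rewrite /rat_norm oppr_eq0 /rat_val numqN denqN abszN. Qed.

Lemma rat_normB x y : rat_norm (x - y) = rat_norm (y - x).
Proof. by rewrite -rat_normN opprB. Qed.

Lemma rat_normV x : rat_norm x^-1 = (rat_norm x)^-1.
Proof.
have [->|x0] := eqVneq x 0; first by rewrite rat_norm0 !invr0 rat_norm0.
have nx0 : rat_norm x != 0 by rewrite rat_norm_eq0.
apply: (mulfI nx0).
by rewrite -rat_normM !divff // rat_norm1.
Qed.

Lemma rat_norm_int (z : int) : rat_norm z%:~R <= 1.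
Proof.
rewrite /rat_norm; case: eqP => // _.
rewrite /rat_val numq_int denq_int logn1 subr0 -invr_expz.
rewrite invf_le1 ?exprz_gt0 // -exprnP exprn_ege1 //.
by rewrite ler1n prime_gt0.
Qed.

Lemma rat_norm_le1 x : rat_norm x <= 1 -> ~~ (p %| `|denq x|)%N.
Proof.
move=> x1; apply/negP => pd; move: x1; apply/negP; rewrite -ltNge.
have x0 : x != 0.
  apply: contraTneq pd => ->; rewrite -[denq 0]/1%Z /=.
  by rewrite dvdn1 neq_ltn prime_gt1 // orbT.
have pn : ~~ (p %| `|numq x|)%N.
  apply/negP => pn; have := coprime_num_den x.
  rewrite /coprime => /eqP e.
  have: (p %| gcdn `|numq x| `|denq x|)%N by rewrite dvdn_gcd pn pd.
  by rewrite e dvdn1 => /eqP p1; have := prime_gt1 p_pr; rewrite p1.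
rewrite /rat_norm (negPf x0) /rat_val.
have -> : logn p `|numq x| = 0%N by rewrite lognE (negPf pn) !andbF.
rewrite sub0r opprK -exprnP exprn_egt1 ?ltr1n ?prime_gt1 //.
by rewrite -lt0n logn_gt0 mem_primes p_pr absz_gt0 denq_neq0.
Qed.

Lemma rat_normD x y : rat_norm (x + y) <= Num.max (rat_norm x) (rat_norm y).
Proof.
wlog le_yx : x y / rat_norm y <= rat_norm x.
  move=> H; case/orP: (le_total (rat_norm y) (rat_norm x)) => /H //.
  by rewrite addrC maxC.
rewrite (max_idPl le_yx).
have [x0|x0] := eqVneq x 0.
  by move: le_yx; rewrite x0 add0r.
have nx0 : 0 < rat_norm x by rewrite lt0r rat_norm_eq0 x0 rat_norm_ge0.
have -> : x + y = x * (1 + y / x) by rewrite mulrDr mulr1 mulrCA divff ?mulr1.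
rewrite rat_normM ger_pMr //.
have : rat_norm (y / x) <= 1 by rewrite rat_normM rat_normV ler_pdivrMr ?mul1r.
move: (y / x) => z z1.
have -> : 1 + z = (denq z + numq z)%:~R / (denq z)%:~R.
  by rewrite rmorphD mulrDl divff ?intr_eq0 ?denq_neq0 // divq_num_den.
rewrite rat_normM rat_normV.
have -> : rat_norm (denq z)%:~R = 1.
  rewrite /rat_norm intr_eq0 denq_eq0 /rat_val numq_int denq_int logn1 subr0.
  by rewrite lognE (negPf (rat_norm_le1 z1)) !andbF oppr0 expr0z.
by rewrite invr1 mulr1 rat_norm_int.
Qed.

Lemma rat_normD_lt x y e :
  rat_norm x < e -> rat_norm y < e -> rat_norm (x + y) < e.
Proof. by move=> xe ye; apply: le_lt_trans (rat_normD x y) _; rewrite gt_max xe. Qed.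

End RatNorm.

Section PadicField.
Variables (p : nat) (p_pr : prime p).
Local Notation "`| x |_p" := (rat_norm p x) (format "`| x |_p").

Definition padic_cauchy of prime p : {pred nat -> rat} := fun u =>
  `[< forall e : rat, 0 < e -> exists N, forall m n, (N <= m)%N -> (N <= n)%N ->
        `| u m - u n |_p < e >].

Lemma padic_cauchyP u : reflect
  (forall e : rat, 0 < e -> exists N, forall m n, (N <= m)%N -> (N <= n)%N ->
     `| u m - u n |_p < e) (u \in padic_cauchy p_pr).
Proof. exact: asboolP. Qed.

Lemma padic_cauchy_bounded u : u \in padic_cauchy p_pr ->
  exists2 B, 0 < B & exists N, forall n, (N <= n)%N -> `| u n |_p < B.
Proof.
move=> /padic_cauchyP /(_ 1 ltr01) [N uN].
exists (Num.max 1 (`| u N |_p + 1)); first by rewrite lt_max ltr01.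
exists N => n Nn; rewrite -[u n](subrK (u N)).
apply: rat_normD_lt => //; rewrite lt_max ?(uN _ _ Nn (leqnn N)) //.
by rewrite ltrDl ltr01 orbT.
Qed.

Lemma padic_cauchy_subring : subring_closed (padic_cauchy p_pr).
Proof.
split=> [|u v|u v].
- apply/padic_cauchyP => e e0; exists 0%N => m n _ _.
  by rewrite subrr rat_norm0.
- move=> /padic_cauchyP uC /padic_cauchyP vC; apply/padic_cauchyP => e e0.
  have [N uN] := uC e e0; have [M vM] := vC e e0; exists (maxn N M) => m n.
  rewrite !geq_max => /andP[Nm Mm] /andP[Nn Mn].
  have -> : (u - v) m - (u - v) n = (u m - u n) + (v n - v m).
    by rewrite !fctE; ring.
  by apply: rat_normD_lt => //; [exact: uN | exact: vM].
- move=> uC0 vC0; have [B B0 [N1 uB]] := padic_cauchy_bounded uC0.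
  have [C C0 [N2 vC]] := padic_cauchy_bounded vC0.
  move: uC0 vC0 => /padic_cauchyP uC0 /padic_cauchyP vC0.
  apply/padic_cauchyP => e e0.
  have [N uN] := uC0 (e / C) (divr_gt0 e0 C0).
  have [M vM] := vC0 (e / B) (divr_gt0 e0 B0).
  exists (maxn (maxn N1 N2) (maxn N M)) => m n; rewrite !geq_max.
  move=> /andP[/andP[N1m N2m] /andP[Nm Mm]] /andP[/andP[N1n N2n] /andP[Nn Mn]].
  have -> : (u * v) m - (u * v) n = (u m - u n) * v n + u m * (v m - v n).
    by rewrite !fctE; ring.
  apply: (rat_normD_lt p_pr); rewrite (rat_normM p_pr).
    rewrite -[e](divfK (lt0r_neq0 C0)).
    by apply: ltr_pM; rewrite ?rat_norm_ge0 ?uN ?vC.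
  rewrite -[e](divfK (lt0r_neq0 B0)) [ltRHS]mulrC.
  by apply: ltr_pM; rewrite ?rat_norm_ge0 ?vM ?uB.
Qed.

HB.instance Definition _ :=
  GRing.isSubringClosed.Build (nat -> rat) (padic_cauchy p_pr)
    padic_cauchy_subring.

Record padic_seq := PadicSeq {
  padic_seq_val :> nat -> rat;
  _ : padic_seq_val \in padic_cauchy p_pr }.

HB.instance Definition _ := [isSub for padic_seq_val].
HB.instance Definition _ := [Choice of padic_seq by <:].
HB.instance Definition _ := [SubChoice_isSubComNzRing of padic_seq by <:].

Lemma padic_seqB (u v : padic_seq) n : (u - v) n = u n - v n.
Proof. by []. Qed.

Lemma padic_seqM (u v : padic_seq) n : (u * v) n = u n * v n.
Proof. by []. Qed.

Definition padic_null : {pred padic_seq} := fun u =>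
  `[< forall e : rat, 0 < e -> exists N, forall n, (N <= n)%N ->
        `| u n |_p < e >].

Lemma padic_nullP (u : padic_seq) : reflect
  (forall e : rat, 0 < e -> exists N, forall n, (N <= n)%N -> `| u n |_p < e)
  (u \in padic_null).
Proof. exact: asboolP. Qed.

Lemma padic_null_ideal : idealr_closed padic_null.
Proof.
split=> [||a u v].
- by apply/padic_nullP => e e0; exists 0%N => n _; rewrite rat_norm0.
- apply/padic_nullP => /(_ 1 ltr01) [N /(_ N (leqnn N))].
  by rewrite [X in rat_norm p X](_ : _ = 1) // rat_norm1 ltxx.
- move=> /padic_nullP uN /padic_nullP vN; apply/padic_nullP => e e0.
  have [B B0 [N1 aB]] := padic_cauchy_bounded (valP a).
  have [N2 uN2] := uN _ (divr_gt0 e0 B0).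
  have [N3 vN3] := vN _ e0.
  exists (maxn (maxn N1 N2) N3) => n; rewrite !geq_max.
  move=> /andP[/andP[N1n N2n] N3n].
  have -> : (a * u + v) n = a n * u n + v n by [].
  apply: (rat_normD_lt p_pr); last exact: vN3.
  rewrite (rat_normM p_pr) -[e](divfK (lt0r_neq0 B0)) [ltRHS]mulrC.
  by apply: ltr_pM; rewrite ?rat_norm_ge0 ?aB ?uN2.
Qed.

HB.instance Definition _ := isIdealr.Build padic_seq padic_null padic_null_ideal.

Definition padic := {ideal_quot padic_null}.

HB.instance Definition _ := GRing.ComNzRing.on padic.

Definition padic_of_seq (u : padic_seq) : padic := \pi_padic u.

Lemma padic_inv_exists (x : padic) : x != 0 -> exists y, y * x = 1.
Proof.
rewrite -[x]reprK; move: (repr x) => u u0.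
have {u0} : u \notin padic_null.
  apply: contra u0 => uN; rewrite -(subr0 u) Quotient.idealrBE in uN.
  by move/eqP: uN => ->; rewrite rmorph0.
move=> /padic_nullP /existsNP [e /not_implyP[e0 /forallNP uN]].
have [N uC] := padic_cauchyP _ (valP u) _ e0.
have {uN} ue n : (N <= n)%N -> e <= `| u n |_p.
  move=> Nn; have /existsNP [m /not_implyP[Nm /negP]] := uN N.
  rewrite -leNgt => um; rewrite leNgt; apply/negP => un.
  have := rat_normD_lt p_pr (uC _ _ Nm Nn) un.
  by rewrite subrK ltNge um.
have u0 n : (N <= n)%N -> u n != 0.
  by move=> /ue; apply: contraTneq => ->; rewrite rat_norm0 -ltNge.
have vC : (fun n => (u n)^-1) \in padic_cauchy p_pr.
  apply/padic_cauchyP => d d0.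
  have [M uM] := padic_cauchyP _ (valP u) _ (mulr_gt0 d0 (mulr_gt0 e0 e0)).
  exists (maxn N M) => m n; rewrite !geq_max => /andP[Nm Mm] /andP[Nn Mn].
  have um0 := u0 _ Nm; have un0 := u0 _ Nn.
  have -> : (u m)^-1 - (u n)^-1 = (u n - u m) / (u m * u n).
    by field; rewrite um0 un0.
  rewrite (rat_normM p_pr) (rat_normV p_pr) (rat_normM p_pr).
  rewrite ltr_pdivrMr; last first.
    by rewrite mulr_gt0 // (lt_le_trans e0) ?ue.
  apply: lt_le_trans (uM _ _ Mn Mm) _.
  by rewrite ler_pM2l // ler_pM ?ue // ltW.
exists (padic_of_seq (PadicSeq vC)).
rewrite /padic_of_seq -rmorphM -(rmorph1 (\pi_padic)).
apply/eqP; rewrite -Quotient.idealrBE; apply/padic_nullP => d d0.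
exists N => n Nn.
have -> : (PadicSeq vC * u - 1) n = (u n)^-1 * u n - 1 by [].
by rewrite mulVf ?u0 // subrr rat_norm0.
Qed.

Definition padic_inv (x : padic) : padic := xget 0 [set y | y * x = 1]%classic.

Lemma padic_mulVf x : x != 0 -> padic_inv x * x = 1.
Proof.
move=> /padic_inv_exists [y xy].
exact: (@xgetI _ 0 [set y | y * x = 1]%classic y).
Qed.

Lemma padic_inv0 : padic_inv 0 = 0.
Proof.
apply: xgetPN => y /= /eqP; by rewrite mulr0 eq_sym oner_eq0.
Qed.

HB.instance Definition _ :=
  GRing.ComNzRing_isField.Build padic padic_mulVf padic_inv0.

(* The norm of a Cauchy class is the limit of the norms along any of its
   representatives; it is again a power of p or 0, hence rational. *)
Definition padic_norm (x : padic) : rat :=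
  xget 0 [set r | exists2 u : padic_seq, x = padic_of_seq u &
    forall e : rat, 0 < e -> exists N, forall n, (N <= n)%N ->
      `| `| u n |_p - r | < e]%classic.

End PadicField.

Section BalancedExpansion.
Variables (p : nat) (p_pr : prime p).

Definition balanced_digits (a : int -> int) : Prop :=
  forall j, (`|a j|%N <= p.-1./2)%N.

(* The sum of a_j p^j over n0 <= j <= m, empty when m < n0. *)
Definition digit_sum (a : int -> int) (n0 m : int) : padic p_pr :=
  \sum_(i < if n0 <= m then `|m - n0|%N.+1 else 0%N)
    (a (n0 + i%:Z))%:~R * p%:R ^ (n0 + i%:Z).

Definition balanced_expansion (a : int -> int) (n0 : int) (b : padic p_pr) :
    Prop :=
  balanced_digits a /\
  forall e : rat, 0 < e -> exists N : int, forall m : int, N <= m ->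
    padic_norm (b - digit_sum a n0 m) < e.

(* For odd p such an expansion exists and its digits are unique (up to padding
   by zeros below n0), so that the default value 0 is not used. *)
Definition padic_floor (b : padic p_pr) : padic p_pr :=
  xget 0 [set c | exists a n0,
    balanced_expansion a n0 b /\ c = digit_sum a n0 0]%classic.

End BalancedExpansion.

Section ContinuedFraction.
Variables (p : nat) (p_pr : prime p) (K : fieldExtType (padic p_pr)) (g : K).

(* coord [tuple 1; g] i x is the i-th coordinate of x in the basis (1, g). *)
Definition ext_floor (x : K) : K :=
  padic_floor (coord [tuple 1; g] 0 x) *: 1 +
  padic_floor (coord [tuple 1; g] 1 x) *: g.

(* None once the process has stopped at an earlier step. *)
Fixpoint complete_quotient (x : K) (n : nat) : option K :=
  if n is n'.+1 then
    if complete_quotient x n' is Some y then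
      if y == ext_floor y then None else Some (y - ext_floor y)^-1
    else None
  else Some x.

Definition finite_cf (x : K) : Prop :=
  exists n y, complete_quotient x n = Some y /\ y = ext_floor y.

(* Membership in the subfield Q(g) of K generated by g over the rationals. *)
Definition in_ratr_adjoin (x : K) : Prop :=
  exists P Q : {poly rat}, (map_poly ratr Q).[g] != 0 /\
    x = (map_poly ratr P).[g] / (map_poly ratr Q).[g].

End ContinuedFraction.

(* Main.v *)
(* The idea is a division algorithm in Z[gamma], where gamma is a root of
   x^2 + e x + 1 with e = 0 or 1, which is irreducible over Q_p. Write
   alpha_n = v / (p w) with v, w in Z[gamma], w nonzero. Since
   alpha_n - c_n has p-adic norm less than 1 and c_n has coordinates in Z[1/p],
   alpha_n - c_n = p w' / w with w' in Z[gamma], so that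
   alpha_(n+1) = w / (p w'). As w' = v / p^2 - (c_n / p) w and the
   coordinates of c_n / p lie in (-1/2, 1/2), the archimedean norm form N gives
   N(w') <= 7 N(v) / p^4 + (7/6) (3/4) N(w), hence 10 N(w) + N(v) strictly
   decreases until w' = 0, where the process stops. *)
From HB Require Import structures.
Require Import Defs.
From mathcomp Require Import all_boot all_order all_algebra all_field.
From mathcomp Require Import boolp zify ring lra.

Set Implicit Arguments.
Unset Strict Implicit.
Unset Printing Implicit Defensive.

Import Order.TTheory GRing.Theory Num.Theory.
Local Open Scope ring_scope.

(** * The p-adic norm and balanced expansions of rationals *)

Section RationalNorm.
Variables (p : nat) (p_pr : prime p).

Let p_gt0 : 0 < p%:R :> rat.
Proof. by rewrite ltr0n prime_gt0. Qed.

Let p_neq0 : p%:R != 0 :> rat.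
Proof. exact: lt0r_neq0. Qed.

Let p_gt1 : 1 < p%:R :> rat.
Proof. by rewrite ltr1n prime_gt1. Qed.

Lemma rat_norm_p : rat_norm p p%:R = p%:R^-1.
Proof.
rewrite /rat_norm (negPf p_neq0) /rat_val !pmulrn numq_int denq_int logn1.
by rewrite subr0 logn_prime // eqxx.
Qed.

Lemma rat_normXz (k : int) : rat_norm p (p%:R ^ k) = p%:R ^ (- k).
Proof.
have rat_normX n : rat_norm p (p%:R ^+ n) = p%:R^-1 ^+ n.
  elim: n => [|n IHn]; first by rewrite rat_norm1.
  by rewrite !exprS rat_normM // IHn rat_norm_p.
case: k => n; first by rewrite -exprnP rat_normX exprVn -exprnN.
by rewrite NegzE opprK -exprnN rat_normV // rat_normX exprVn invrK exprnP.
Qed.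

Lemma rat_norm_lt1_int (z : int) : (p %| z)%Z -> rat_norm p z%:~R < 1.
Proof.
case/dvdzP => k ->; rewrite rmorphM /= rat_normM // -pmulrn rat_norm_p.
rewrite ltr_pdivrMr // mul1r.
by apply: le_lt_trans p_gt1; exact: rat_norm_int.
Qed.

(** The norm takes only the value 0 and powers of [p], so a norm below 1 is at most [1/p]. *)
Lemma rat_norm_divp (x : rat) : rat_norm p x < 1 -> rat_norm p (x / p%:R) <= 1.
Proof.
rewrite rat_normM // rat_normV // rat_norm_p invrK /rat_norm.
case: eqP => [|_]; first by rewrite mul0r.
move: (- rat_val p x) => k; rewrite -(expr0z (p%:R : rat)).
rewrite ltr_eXz2l // => k0.
by rewrite -[X in _ * X]expr1z -expfzDr // ler_eXz2l //; lia.
Qed.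

Lemma rat_norm_mulXp_le1 (x : rat) : exists k : nat,
  rat_norm p (x * p%:R ^+ k) <= 1.
Proof.
exists `|rat_val p x|%N; rewrite rat_normM // exprnP rat_normXz /rat_norm.
case: eqP => _; first by rewrite mul0r.
by rewrite -expfzDr // -[leRHS](expr0z (p%:R : rat)) ler_eXz2l //; lia.
Qed.

(** The denominator of [x] is prime to [p] by the norm bound and divides [p^k] by the equation, so
    it is 1. *)
Lemma rat_norm_le1_int (x : rat) (k : nat) (z : int) :
  rat_norm p x <= 1 -> x * p%:R ^+ k = z%:~R -> exists y : int, x = y%:~R.
Proof.
move=> /(rat_norm_le1 p_pr) pN xz; exists (numq x).
suff d1 : denq x = 1 by rewrite -{1}[x]divq_num_den d1 divr1.
have e : numq x * p%:Z ^+ k = z * denq x.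
  apply/(@intr_inj rat); rewrite !rmorphM /= rmorphXn /= numqE -xz pmulrn.
  by rewrite mulrAC.
have : (`|denq x| %| `|numq x| * p ^ k)%N.
  move/(congr1 absz): e; rewrite !abszM abszX absz_nat => ->.
  exact: dvdn_mull.
rewrite Gauss_dvdr; last by rewrite coprime_sym coprime_num_den.
move=> d; have : coprime `|denq x| (p ^ k).
  by rewrite coprimeXr // coprime_sym prime_coprime.
rewrite /coprime (gcdn_idPl d) => /eqP.
by have := denq_gt0 x; lia.
Qed.

Lemma rat_norm_denq (x : rat) : rat_norm p x <= 1 ->
  rat_norm p (denq x)%:~R = 1.
Proof.
move=> /(rat_norm_le1 p_pr) pN; rewrite /rat_norm intr_eq0 denq_eq0 /rat_val.
by rewrite numq_int denq_int logn1 subr0 lognE (negPf pN) !andbF oppr0 expr0z.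
Qed.

Lemma balanced_digit_exists (x : rat) : odd p -> rat_norm p x <= 1 ->
  exists d : int, (`|d| <= p.-1./2)%N /\ rat_norm p (x - d%:~R) < 1.
Proof.
move=> p_odd x1; have pN := rat_norm_le1 p_pr x1.
have cop : coprimez (denq x) p by rewrite coprimezE coprime_sym prime_coprime.
have [[u v] /= uv] := coprimezP _ _ cop.
(* By Bezout, [u] inverts the denominator modulo [p], so [d0] is congruent to [x]. Shifting by [h]
   before and after reduction selects the residue in [[-h, h]]. *)
pose h : int := p.-1./2; pose d0 := numq x * u.
have p_h : p%:Z = h *+ 2 + 1 by rewrite /h; have := prime_gt1 p_pr; lia.
exists (((d0 + h) %% p)%Z - h); split.
  have := ltz_pmod (d0 + h) (_ : 0 < p%:Z).
  have := modz_ge0 (d0 + h) (_ : p%:Z != 0).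
  by have := prime_gt1 p_pr; lia.
set d := _ - h.
have -> : x - d%:~R = (numq x * (1 - u * denq x))%:~R / (denq x)%:~R
     + (d0 - d)%:~R.
  rewrite -{1}[x]divq_num_den !(rmorphM, rmorphB) /= /d0.
  by field; rewrite intr_eq0 denq_eq0.
apply: (rat_normD_lt p_pr); last first.
  apply: rat_norm_lt1_int; apply/dvdzP; exists ((d0 + h) %/ p)%Z.
  by have := divz_eq (d0 + h) p; rewrite /d; lia.
rewrite rat_normM // rat_normV // rat_norm_denq // divr1.
apply: rat_norm_lt1_int; apply/dvdzP; exists (numq x * v).
by rewrite -mulrA; congr (_ * _); lia.
Qed.

Definition rat_digit_sum (a : int -> int) (n0 m : int) : rat :=
  \sum_(i < if n0 <= m then `|m - n0|%N.+1 else 0%N)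
    (a (n0 + i%:Z))%:~R * p%:R ^ (n0 + i%:Z).

(** The top term is at most [(p-1) p^n / 2] in absolute value, and the lower ones together stay
    below [p^n / 2]. *)
Lemma balanced_sum_lt (a : nat -> int) (n : nat) : odd p ->
  (forall i, (`|a i| <= p.-1./2)%N) ->
  (`|(\sum_(i < n) a i * p%:Z ^+ i)%R| * 2 < p ^ n)%N.
Proof.
move=> p_odd aP; elim: n => [|n IHn]; first by rewrite big_ord0.
rewrite big_ord_recr /= expnS.
have ha : (`|(a n * p%:Z ^+ n)%R| * 2 <= p.-1 * p ^ n)%N.
  rewrite abszM abszX absz_nat mulnAC leq_mul2r; apply/orP; right.
  by have := aP n; have := prime_gt1 p_pr; lia.
have := prime_gt1 p_pr; move: IHn ha.
move: (\sum_(i < n) _) (a n * _) (p ^ n)%N => x y q.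
case: (p) => // p' /=; rewrite mulSn; lia.
Qed.

(** Scaling by [p^k] with [k = -n0] gives the integer sum of [balanced_sum_lt]. The bound on [z]
    places the truncation in [(-p/2, p/2)]. *)
Lemma rat_digit_sum0P (a : int -> int) (n0 : int) : odd p ->
    balanced_digits p a ->
  exists (k : nat) (z : int),
    rat_digit_sum a n0 0 * p%:R ^+ k = z%:~R /\ (`|z| * 2 < p ^ k.+1)%N.
Proof.
move=> p_odd aP; rewrite /rat_digit_sum; case: ifP => n0P; last first.
  by exists 0%N, 0; rewrite big_ord0 mul0r expn1 mul0n prime_gt0.
exists `|n0|%N, (\sum_(i < `|n0|.+1) a (n0 + i%:Z) * p%:Z ^+ i); split.
  rewrite sub0r abszN mulr_suml rmorph_sum; apply: eq_bigr => i _.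
  rewrite rmorphM /= rmorphXn /= -mulrA; congr (_ * _).
  rewrite exprnP -expfzDr // exprnP -pmulrn; congr (_ ^ _); lia.
exact: (balanced_sum_lt (a := fun i => a (n0 + i%:Z))).
Qed.

Lemma rat_digit_sumS (a : int -> int) (n0 : int) (m : nat) :
  exists d : int, rat_digit_sum a n0 m.+1 = rat_digit_sum a n0 m + d%:~R * p%:R.
Proof.
pose t : rat := (a m.+1)%:~R * p%:R ^ m.+1%:Z.
have tE : t = (a m.+1 * p%:Z ^+ m)%:~R * p%:R.
  by rewrite /t rmorphM /= rmorphXn /= -mulrA -pmulrn -exprnP exprSr.
rewrite /rat_digit_sum; case: (leP n0 m.+1%:Z) => n0S; last first.
  exists 0; rewrite (_ : (n0 <= m%:Z) = false); last by lia.
  by rewrite big_ord0 mul0r addr0.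
exists (a m.+1 * p%:Z ^+ m); rewrite -tE big_ord_recr /=.
have -> : n0 + `|m.+1%:Z - n0|%N%:Z = m.+1 by lia.
congr (_ + _); case: (leP n0 m%:Z) => n0m.
  by have -> : `|m.+1%:Z - n0|%N = `|m%:Z - n0|%N.+1 by lia.
by have -> : `|m.+1%:Z - n0|%N = 0%N by lia.
Qed.

Lemma rat_digit_sum_tail (a : int -> int) (n0 : int) (m : nat) :
  rat_norm p (rat_digit_sum a n0 m - rat_digit_sum a n0 0) < 1.
Proof.
elim: m => [|m IHm]; first by rewrite subrr rat_norm0.
have [d ->] := rat_digit_sumS a n0 m; rewrite addrAC.
apply: (rat_normD_lt p_pr) => //.
rewrite pmulrn -rmorphM; apply: rat_norm_lt1_int; exact: dvdz_mull.
Qed.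

Lemma expp_inv_lt (e : rat) : 0 < e -> exists N : nat, forall m : int,
  N%:Z <= m -> p%:R ^ (- m) < e.
Proof.
move=> e0; have [N Ne] : exists N : nat, e^-1 < N%:R.
  by exists (Num.bound e^-1); apply: archi_boundP; rewrite invr_ge0 ltW.
exists N => -[m Nm|//]; rewrite -invr_expz -(invrK e) ltf_pV2 ?posrE;
  rewrite ?invr_gt0 ?exprz_gt0 //.
apply: lt_le_trans Ne _; rewrite -exprnP -natrX ler_nat.
by apply: leq_trans Nm _; apply: ltnW; apply: ltn_expl; apply: prime_gt1.
Qed.

Lemma rat_balanced_expansion (x : rat) : odd p ->
  exists (a : int -> int) (n0 : int), balanced_digits p a /\
    forall e : rat, 0 < e -> exists N : nat, forall m : int, N%:Z <= m ->
      rat_norm p (x - rat_digit_sum a n0 m) < e.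
Proof.
move=> p_odd; have [k xk] := rat_norm_mulXp_le1 x.
(* A digit function on all rationals, with default 0 outside the [p]-integral ones. *)
have [|dig digP] := @choice rat int (fun y d => (`|d| <= p.-1./2)%N /\
    (rat_norm p y <= 1 -> rat_norm p (y - d%:~R) < 1)).
  move=> y; have [y1|y1] := boolP (rat_norm p y <= 1).
    by have [d [? ?]] := balanced_digit_exists p_odd y1; exists d.
  by exists 0; split.
(* [next] strips the lowest digit and shifts, so [y n] is what remains of [x p^k] after [n] digits.
   For [j < -k] the absolute value in [a j] yields arbitrary balanced digits, which no sum from [-k]
   on reads. *)
pose next y := (y - (dig y)%:~R) / p%:R.
pose y n := iter n next (x * p%:R ^+ k).
have y1 n : rat_norm p (y n) <= 1.
  elim: n => [//|n IHn]; apply: rat_norm_divp; exact: (digP _).2.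
pose a (j : int) := dig (y `|(j + k%:Z)%R|%N); exists a, (- k%:Z).
split=> [j|e e0]; first exact: (digP _).1.
have rest n : x - \sum_(i < n) (a (- k%:Z + i%:Z))%:~R * p%:R ^ (- k%:Z + i%:Z)
    = p%:R ^ (- k%:Z + n%:Z) * y n.
  elim: n => [|n IHn].
    rewrite big_ord0 subr0 addr0 /y /= mulrC -mulrA exprnP -expfzDr // subrr.
    by rewrite expr0z mulr1.
  rewrite big_ord_recr /= opprD addrA IHn /a.
  have -> : `|(- k%:Z + n%:Z + k%:Z)%R|%N = n by lia.
  have -> : - k%:Z + n.+1%:Z = (- k%:Z + n%:Z) + 1 by lia.
  by rewrite [in RHS]expfzDr // expr1z /next; field.
have [N NP] := expp_inv_lt e0; exists N => m Nm.
rewrite /rat_digit_sum ifT; last by lia.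
rewrite rest rat_normM // rat_normXz.
have -> : - k%:Z + `|(m - - k%:Z)%R|.+1%:Z = m + 1 by lia.
apply: le_lt_trans (NP (m + 1) _); last by lia.
by rewrite ler_piMr // exprz_ge0 // ltW.
Qed.

End RationalNorm.

(** * The embedding of the rationals into Q_p *)

Section PadicRational.
Variables (p : nat) (p_pr : prime p).

Lemma padic_cauchy_cst (x : rat) : (fun=> x) \in padic_cauchy p_pr.
Proof.
by apply/padic_cauchyP => e e0; exists 0%N => m n _ _; rewrite subrr rat_norm0.
Qed.

(** Constant sequences, rather than [ratr], give a representative from which the norm can be read
    off. *)
Definition rat_padic (x : rat) : padic p_pr :=
  padic_of_seq (PadicSeq (padic_cauchy_cst x)).

Lemma rat_padic_is_zmod_morphism : zmod_morphism rat_padic.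
Proof.
move=> x y; rewrite /rat_padic /padic_of_seq -rmorphB /=.
by congr (\pi_(padic p_pr)%qT _); apply: val_inj.
Qed.

Lemma rat_padic_is_monoid_morphism : monoid_morphism rat_padic.
Proof.
split=> [|x y].
  rewrite /rat_padic /padic_of_seq -(rmorph1 (\pi_(padic p_pr)%qT)) /=.
  by congr (\pi_(padic p_pr)%qT _); apply: val_inj.
rewrite /rat_padic /padic_of_seq -rmorphM /=.
by congr (\pi_(padic p_pr)%qT _); apply: val_inj.
Qed.

HB.instance Definition _ := GRing.isZmodMorphism.Build rat (padic p_pr)
  rat_padic rat_padic_is_zmod_morphism.
HB.instance Definition _ := GRing.isMonoidMorphism.Build rat (padic p_pr)
  rat_padic rat_padic_is_monoid_morphism.

Lemma padic_of_seq_eqP (u v : padic_seq p_pr) :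
  padic_of_seq u = padic_of_seq v ->
  forall e : rat, 0 < e -> exists N, forall n, (N <= n)%N ->
    rat_norm p (u n - v n) < e.
Proof.
move=> /eqP; rewrite /padic_of_seq.
by rewrite -(Quotient.idealrBE (padic_null (p_pr := p_pr))) => /padic_nullP.
Qed.

Lemma rat_norm_dist (x y : rat) :
  `|rat_norm p x - rat_norm p y| <= rat_norm p (x - y).
Proof.
have H a b : rat_norm p a - rat_norm p b <= rat_norm p (a - b).
  have := rat_normD p_pr (a - b) b; rewrite subrK le_max.
  by have := rat_norm_ge0 p (a - b); have := rat_norm_ge0 p b; lra.
by rewrite ler_norml H lerNl opprB rat_normB // H.
Qed.

Lemma padic_norm_rat (x : rat) : padic_norm (rat_padic x) = rat_norm p x.
Proof.
rewrite /padic_norm; set S := (X in classical_sets.xget _ X).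
have /(classical_sets.xgetI 0) : S (rat_norm p x).
  exists (PadicSeq (padic_cauchy_cst x)) => // e e0; exists 0%N => n _ /=.
  by rewrite subrr normr0.
move: (classical_sets.xget 0 S) => r [u xu ur].
(* The selected [r] is a limit along some [u] equivalent to the constant sequence [x]. Half the
   distance from [r] to the norm of [x] is the tolerance for both approximations. *)
apply/eqP; rewrite -subr_eq0 -normr_eq0; apply: contraT => r0.
have d0 : 0 < `|r - rat_norm p x| / 2.
  by rewrite divr_gt0 // lt0r r0 normr_ge0.
have [N uN] := ur _ d0; have [M uM] := padic_of_seq_eqP xu d0.
have := uN _ (leq_maxl N M); have := uM _ (leq_maxr N M) => /=.
rewrite rat_normB // => H1 H2.
have := rat_norm_dist (u (maxn N M)) x; move: H1 H2.
set q := rat_norm p (u _); move: (rat_norm p (_ - _)) => w wx qr qw.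
have := ler_normD (r - q) (q - rat_norm p x).
rewrite addrA subrK => /le_lt_trans; rewrite distrC => /(_ `|r - rat_norm p x|).
by rewrite distrC ltxx; apply; rewrite distrC; lra.
Qed.

Lemma digit_sum_rat (a : int -> int) (n0 m : int) :
  digit_sum p_pr a n0 m = rat_padic (rat_digit_sum p a n0 m).
Proof.
rewrite /digit_sum /rat_digit_sum rmorph_sum /=; apply: eq_bigr => i _.
by rewrite rmorphM /= rmorph_int fmorphXz rmorph_nat.
Qed.

(** Whichever balanced expansion of [x] is selected by [xget], its truncation [f] has these
    properties. *)
Lemma padic_floor_rat (x : rat) : odd p ->
  exists (f : rat) (k : nat) (z : int),
    [/\ padic_floor (rat_padic x) = rat_padic f, f * p%:R ^+ k = z%:~R,
        (`|z| * 2 < p ^ k.+1)%N & rat_norm p (x - f) < 1].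
Proof.
move=> p_odd; rewrite /padic_floor; set S := (X in classical_sets.xget _ X).
have [a [n0 [aP xP]]] := rat_balanced_expansion p_pr x p_odd.
have /(classical_sets.xgetI 0) : S (digit_sum p_pr a n0 0).
  exists a, n0; split=> //; split=> // e e0; have [N NP] := xP e e0.
  exists N%:Z => m /NP; by rewrite digit_sum_rat -rmorphB padic_norm_rat.
move: (classical_sets.xget 0 S) => _ [b [m0 [[bP bx] ->]]].
have [k [z [zE zlt]]] := rat_digit_sum0P p_pr m0 p_odd bP.
exists (rat_digit_sum p b m0 0), k, z; split=> //; first exact: digit_sum_rat.
(* Precision 1 suffices: the partial sum up to [|N|] differs from both [x] and the truncation by
   norms below 1. *)
have [N NP] := bx 1 ltr01.
have := NP `|N|%N%:Z (ler_norm N).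
rewrite digit_sum_rat -rmorphB padic_norm_rat => xlt.
rewrite -(subrKA (rat_digit_sum p b m0 `|N|%N)).
by apply: (rat_normD_lt p_pr) => //; apply: rat_digit_sum_tail.
Qed.

End PadicRational.

(** * Irreducibility over Q_p *)

Section NoRoot.
Variables (p : nat) (p_pr : prime p) (e : int).
Hypothesis p_e : e = 0 /\ (p %% 4 = 3)%N \/ e = 1 /\ (p %% 12 = 5)%N.

(** Compare with Fermat's [y^p = y]. If [y^2 = -1] and [p] is 3 mod 4, then [y^p = -y], so [y = 0].
    If [y^2 + y + 1 = 0], then [y^3 = 1] and [y^p = y^2], so [y] is 0 or 1, and [y = 1] would give
    [3 = 0]. *)
Lemma Fp_no_root (y : 'F_p) : y ^+ 2 + e%:~R * y + 1 != 0.
Proof.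
apply/eqP => yE; have yp : y ^+ p = y.
  by rewrite -[in X in _ ^+ X](card_Fp p_pr) expf_card.
have n0 k : (0 < k < p)%N -> k%:R != 0 :> 'F_p.
  by move=> /andP[k0 kp]; rewrite -(dvdn_pcharf (pchar_Fp p_pr)) gtnNdvd.
case: p_e yE => -[-> pm]; rewrite ?mul0r ?mul1r ?addr0 => yE.
  have y2 : y ^+ 2 = -1 by apply/eqP; rewrite -addr_eq0 yE.
  have p_y : y ^+ p = - y.
    rewrite [X in _ ^+ X](divn_eq p 4) pm exprD mulnC exprM.
    by rewrite (_ : 4 = 2 * 2)%N // exprM y2 sqrrN !expr1n mul1r exprS y2 mulrN1.
  have /eqP : y * 2%:R = 0 by rewrite mulr_natr mulr2n -{1}yp p_y addNr.
  rewrite mulf_eq0 (negPf (n0 2%N _)) ?orbF; last by lia.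
  move=> /eqP y0; move: yE; rewrite y0 expr0n /= add0r => /eqP.
  by rewrite oner_eq0.
have y3 : y ^+ 3 = 1.
  apply/eqP; rewrite -subr_eq0.
  rewrite subrX1 !big_ord_recr big_ord0 /= add0r [_ + y ^+ 2]addrC.
  by rewrite (addrC _ y) addrA yE mulr0.
have p_y : y ^+ p = y ^+ 2.
  rewrite [X in _ ^+ X](divn_eq p 12) pm exprD mulnC exprM.
  rewrite (_ : 12 = 3 * 4)%N // exprM y3.
  by rewrite !expr1n mul1r (_ : 5 = 3 + 2)%N // exprD y3 mul1r.
have /eqP : y * (y - 1) = 0 by rewrite mulrBr mulr1 -expr2 -p_y yp subrr.
rewrite mulf_eq0 subr_eq0 => /orP[] /eqP y0; move: yE; rewrite y0.
  by rewrite expr0n /= !add0r => /eqP; rewrite oner_eq0.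
rewrite expr1n -[1]/(1%:R) -!natrD => /eqP; rewrite (negPf (n0 3%N _)) //; lia.
Qed.

Lemma rat_norm_lt1_dvd (z : int) : rat_norm p z%:~R < 1 -> (p %| z)%Z.
Proof.
rewrite /rat_norm intr_eq0; case: eqP => [-> //|/eqP z0].
rewrite dvdzE /=; apply: contraTT => pN; rewrite /rat_val numq_int denq_int.
by rewrite logn1 lognE (negPf pN) !andbF oppr0 expr0z ltxx.
Qed.

Lemma Fp_int_eq0 (z : int) : (z%:~R == 0 :> 'F_p) = (p %| z)%Z.
Proof.
rewrite dvdzE /= (dvdn_pcharf (pchar_Fp p_pr)).
by case: (intP z) => // n; rewrite ?abszN ?rmorphN ?oppr_eq0 -?pmulrn.
Qed.

(** If the value had norm below 1, then [u] would be [p]-integral, since otherwise [u^2] dominates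
    the other terms; reducing [u] modulo [p] would give a root in ['F_p]. *)
Lemma rat_no_root (u : rat) : 1 <= rat_norm p (u ^+ 2 + e%:~R * u + 1).
Proof.
rewrite leNgt; apply/negP => uP.
have le_e1 (v : rat) : rat_norm p (e%:~R * v) <= rat_norm p v.
  by rewrite rat_normM // ler_piMl ?rat_norm_ge0 // rat_norm_int.
have u1 : rat_norm p u <= 1.
  rewrite leNgt; apply/negP => u1.
  have := rat_normD p_pr (u ^+ 2 + e%:~R * u + 1) (- (e%:~R * u + 1)).
  have -> : u ^+ 2 + e%:~R * u + 1 - (e%:~R * u + 1) = u * u by ring.
  have := rat_normD p_pr (e%:~R * u) 1; have := le_e1 u.
  rewrite rat_normN rat_normM // rat_norm1 => h1 h2.
  have {}h2 : rat_norm p (e%:~R * u + 1) <= rat_norm p u.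
    by apply: le_trans h2 _; rewrite ge_max h1 ltW.
  rewrite le_max => /orP[]; nra.
set s := numq u; set t := denq u.
have t0 : t%:~R != 0 :> rat by rewrite intr_eq0 denq_eq0.
have := rat_norm_denq p_pr u1; rewrite -/t => nt.
have tF : t%:~R != 0 :> 'F_p.
  by rewrite Fp_int_eq0 dvdzE; exact: rat_norm_le1.
have : (p %| s ^+ 2 + e * s * t + t ^+ 2)%Z.
  apply: rat_norm_lt1_dvd.
  have -> : (s ^+ 2 + e * s * t + t ^+ 2)%:~R =
      (u ^+ 2 + e%:~R * u + 1) * (t%:~R * t%:~R).
    rewrite -[u]divq_num_den -/s -/t !(rmorphD, rmorphM, rmorphXn) /=.
    by field.
  by rewrite !rat_normM // nt !mulr1.
rewrite -Fp_int_eq0 => /eqP st; have /eqP := Fp_no_root (s%:~R / t%:~R); apply.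
apply: (mulIf (expf_neq0 2 tF)); rewrite mul0r -[RHS]st.
by rewrite !(rmorphD, rmorphM, rmorphXn) /=; field.
Qed.

Lemma padic_seq_int (z : int) (n : nat) : (z%:~R : padic_seq p_pr) n = z%:~R.
Proof.
have H k : (k%:R : padic_seq p_pr) n = k%:R.
  by elim: k => // k IHk; rewrite [in RHS]mulrS -IHk [in LHS]mulrS.
by case: z => k; rewrite ?NegzE ?rmorphN /= -pmulrn; [|congr (- _)]; apply: H.
Qed.

(** Along a Cauchy sequence representing a root, the polynomial values tend to 0, against the
    uniform lower bound of [rat_no_root]. *)
Lemma padic_no_root (z : padic p_pr) : z ^+ 2 + e%:~R * z + 1 != 0.
Proof.
apply/eqP; rewrite -[z]reprK; move: (repr z) => u.
rewrite -(rmorph_int (\pi_(padic p_pr)%qT)) -(rmorph1 (\pi_(padic p_pr)%qT)).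
rewrite -rmorphXn -rmorphM -!rmorphD -(rmorph0 (\pi_(padic p_pr)%qT)) => uE.
have [N /(_ N (leqnn N))] := padic_of_seq_eqP uE ltr01.
set w := (X in rat_norm p X < 1) => w1.
have : w = u N ^+ 2 + e%:~R * u N + 1.
  rewrite /w subr0; congr (_ + _ * _ + _).
  exact: padic_seq_int.
by move=> wE; have := rat_no_root (u N); rewrite -wE leNgt w1.
Qed.

End NoRoot.

(** * The archimedean norm form *)

Section QuadraticNorm.
Variable e : int.
Hypothesis e01 : e = 0 \/ e = 1.

(** The field norm of [a + b g] for [g] a root of [x^2 + e x + 1]; the ring is a parameter to cover
    both integers and rationals. *)
Definition qnorm (R : comPzRingType) (a b : R) : R :=
  a ^+ 2 - e%:~R * a * b + b ^+ 2.

Lemma qnorm_int (a b : int) : (qnorm a b)%:~R = qnorm a%:~R b%:~R :> rat.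
Proof. by rewrite /qnorm !(rmorphD, rmorphN, rmorphM, rmorphXn) /= !intz. Qed.

Lemma qnorm_ge0 (a b : rat) : 0 <= qnorm a b.
Proof. by rewrite /qnorm; case: e01 => ->; nra. Qed.

Lemma qnorm_eq0 (a b : rat) : qnorm a b = 0 -> a = 0 /\ b = 0.
Proof.
rewrite /qnorm; case: e01 => -> H.
  have a0 : a ^+ 2 = 0 by nra.
  have b0 : b ^+ 2 = 0 by nra.
  by split; apply/eqP; rewrite -sqrf_eq0; apply/eqP.
have a0 : a ^+ 2 = 0 by nra.
have b0 : b ^+ 2 = 0 by nra.
by split; apply/eqP; rewrite -sqrf_eq0; apply/eqP.
Qed.

(** The arguments on the left are the coordinates of [(a + b g)(c + d g)]. *)
Lemma qnormM (R : comPzRingType) (a b c d : R) :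
  qnorm (a * c - b * d) (a * d + b * c - e%:~R * b * d) = qnorm a b * qnorm c d.
Proof. by rewrite /qnorm; ring. Qed.

(** A weighted parallelogram bound with weights [1 + 6] and [1 + 1/6]: the defect is one sixth of
    the form at [6 (a, b) + (c, d)]. *)
Lemma qnormB_le (a b c d : rat) :
  qnorm (a - c) (b - d) <= qnorm a b * 7 + qnorm c d * (7 / 6).
Proof.
rewrite -subr_ge0.
have -> : qnorm a b * 7 + qnorm c d * (7 / 6) - qnorm (a - c) (b - d) =
    qnorm (6 * a + c) (6 * b + d) / 6 by rewrite /qnorm; field.
exact: divr_ge0 (qnorm_ge0 _ _) (ler0n _ 6).
Qed.

(** The extreme case is [e = 1] at [a = -b = 1/2]; a bound below 1 is what makes the division
    Euclidean. *)
Lemma qnorm_half (a b : rat) : `|a| <= 2^-1 -> `|b| <= 2^-1 ->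
  qnorm a b <= 3 / 4.
Proof.
rewrite !ler_norml /qnorm => /andP[a1 a2] /andP[b1 b2].
by case: e01 => ->; nra.
Qed.

(* With [q = p], the first two arguments are the coordinates of
   [v / p ^ 2 - (f / p) w] for a partial quotient [f]. *)
Lemma qnorm_descent (q f0 f1 v0 v1 w0 w1 : rat) :
    3 <= q -> `|f0| <= q / 2 -> `|f1| <= q / 2 -> 0 < qnorm w0 w1 ->
  10 * qnorm (v0 / q ^+ 2 - (f0 * w0 - f1 * w1) / q)
             (v1 / q ^+ 2 - (f0 * w1 + f1 * w0 - e%:~R * f1 * w1) / q)
    + qnorm w0 w1 < 10 * qnorm w0 w1 + qnorm v0 v1.
Proof.
move=> q3 hf0 hf1 wgt0; have q0 : 0 < q by lra.
have h := qnormB_le (v0 / q ^+ 2) (v1 / q ^+ 2)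
  ((f0 * w0 - f1 * w1) / q) ((f0 * w1 + f1 * w0 - e%:~R * f1 * w1) / q).
have hv : qnorm (v0 / q ^+ 2) (v1 / q ^+ 2) <= qnorm v0 v1 / 3 ^+ 4.
  have -> : qnorm (v0 / q ^+ 2) (v1 / q ^+ 2) = qnorm v0 v1 / q ^+ 4.
    by rewrite /qnorm; field; rewrite lt0r_neq0.
  apply: (ler_wpM2l (qnorm_ge0 v0 v1)).
  have h3 : 0 < 3 :> rat by rewrite ltr0n.
  rewrite lef_pV2 ?posrE; [|exact: exprn_gt0..].
  by apply: lerXn2r q3; rewrite nnegrE ltW.
have hf : qnorm ((f0 * w0 - f1 * w1) / q)
    ((f0 * w1 + f1 * w0 - e%:~R * f1 * w1) / q) <= 3 / 4 * qnorm w0 w1.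
  have -> : (f0 * w0 - f1 * w1) / q = f0 / q * w0 - f1 / q * w1.
    by field; rewrite lt0r_neq0.
  have -> : (f0 * w1 + f1 * w0 - e%:~R * f1 * w1) / q =
      f0 / q * w1 + f1 / q * w0 - e%:~R * (f1 / q) * w1.
    by field; rewrite lt0r_neq0.
  rewrite qnormM ler_wpM2r ?qnorm_ge0 // qnorm_half // normrM normfV;
    by rewrite ler_pdivrMr ?normr_gt0 ?gt_eqF // (gtr0_norm q0) mulrC.
(* The coefficients on the left are at most [10 * 7 / 81 < 1] for [v] and
   [10 * (7/6) * (3/4) + 1 = 9.75 < 10] for [w]. *)
have := qnorm_ge0 v0 v1; move: h hv hf wgt0.
move: (qnorm _ _) (qnorm _ _) (qnorm _ _) (qnorm v0 v1) (qnorm w0 w1).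
by move=> *; lra.
Qed.

End QuadraticNorm.

(** * Continued fractions of elements of Q(gamma) *)

Section RationalSubfield.
Variables (p : nat) (p_pr : prime p) (K : fieldExtType (padic p_pr)) (g : K).
Variable e : int.
Hypothesis p_e : e = 0 /\ (p %% 4 = 3)%N \/ e = 1 /\ (p %% 12 = 5)%N.
Hypothesis g_root : g ^+ 2 + e%:~R * g + 1 = 0.

Let e01 : e = 0 \/ e = 1.
Proof. by case: p_e => -[]; [left|right]. Qed.

Let p_odd : odd p.
Proof. by case: p_e => -[_]; lia. Qed.

Let p_ge3 : (3 <= p)%N.
Proof. by case: p_e => -[_]; lia. Qed.

Definition rat_ext : rat -> K := in_alg K \o rat_padic p_pr.

HB.instance Definition _ := GRing.RMorphism.on rat_ext.

Definition ext_of_rat2 (a b : rat) : K := rat_ext a + rat_ext b * g.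

Lemma ext_of_rat2M (a b c d : rat) : ext_of_rat2 a b * ext_of_rat2 c d =
  ext_of_rat2 (a * c - b * d) (a * d + b * c - e%:~R * b * d).
Proof.
have g2 : g ^+ 2 = - e%:~R * g - 1.
  by apply/eqP; rewrite -subr_eq0 -g_root; apply/eqP; ring.
rewrite /ext_of_rat2 !(rmorphD, rmorphN, rmorphM, rmorph_int) /=.
transitivity (rat_ext a * rat_ext c + rat_ext b * rat_ext d * g ^+ 2
  + (rat_ext a * rat_ext d + rat_ext b * rat_ext c) * g); first by ring.
by rewrite g2; ring.
Qed.

Lemma ext_of_rat2D (a b c d : rat) :
  ext_of_rat2 a b + ext_of_rat2 c d = ext_of_rat2 (a + c) (b + d).
Proof. by rewrite /ext_of_rat2 !rmorphD /=; ring. Qed.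

Lemma ext_of_rat2B (a b c d : rat) :
  ext_of_rat2 a b - ext_of_rat2 c d = ext_of_rat2 (a - c) (b - d).
Proof. by rewrite /ext_of_rat2 !rmorphB /=; ring. Qed.

Lemma ext_of_rat2_0 : ext_of_rat2 0 0 = 0.
Proof. by rewrite /ext_of_rat2 !rmorph0 mul0r addr0. Qed.

(** A linear relation would put [g] in the base field, where the polynomial has no root. Freeness is
    what gives [coord] its meaning in [ext_floor]. *)
Lemma free_1g : free [tuple 1; g].
Proof.
have g0 : g != 0.
  apply: contra_eq_neq g_root => ->.
  by rewrite expr0n mulr0 !add0r oner_neq0.
rewrite free_cons seq1_free g0 andbT span_seq1; apply/negP => /vlineP[k gk].
have k0 : k != 0.
  by apply: contra_eq_neq gk => ->; rewrite scale0r oner_neq0.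
have gE : g = in_alg K k^-1.
  by rewrite /= gk scalerA mulVf // scale1r.
have /eqP := padic_no_root p_e k^-1; apply; apply: (fmorph_inj (in_alg K)).
rewrite rmorph0 -[RHS]g_root gE.
by rewrite !(rmorphD, rmorphM, rmorphXn, rmorph_int, rmorph1).
Qed.

Lemma coord_ext_of_rat2 (a b : rat) :
  coord [tuple 1; g] 0 (ext_of_rat2 a b) = rat_padic p_pr a /\
  coord [tuple 1; g] 1 (ext_of_rat2 a b) = rat_padic p_pr b.
Proof.
have -> : ext_of_rat2 a b = \sum_(i < 2)
    (if i == 0 then rat_padic p_pr a else rat_padic p_pr b) *: [tuple 1; g]`_i.
  by rewrite !big_ord_recl big_ord0 /= addr0 /ext_of_rat2 /rat_ext /= mulr_algl.
by rewrite !(coord_sum_free _ _ free_1g).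
Qed.

Lemma ext_of_rat2_eq0 (a b : rat) : ext_of_rat2 a b = 0 -> a = 0 /\ b = 0.
Proof.
move=> ab0; have [] := coord_ext_of_rat2 a b.
by rewrite ab0 !linear0 => /esym/eqP; rewrite fmorph_eq0 => /eqP->
  /esym/eqP; rewrite fmorph_eq0 => /eqP->.
Qed.

Lemma ext_of_rat2_div (a b c d : rat) : ext_of_rat2 c d != 0 ->
  exists x y, ext_of_rat2 a b / ext_of_rat2 c d = ext_of_rat2 x y.
Proof.
move=> cd0; have N0 : qnorm e c d != 0.
  apply: contra_neq cd0 => /(qnorm_eq0 e01)[-> ->]; exact: ext_of_rat2_0.
(* Multiply by the conjugate [(c - e d) - d g] of the denominator. *)
exists ((a * (c - e%:~R * d) + b * d) / qnorm e c d).
exists ((b * c - a * d) / qnorm e c d).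
apply: (mulIf cd0); rewrite divfK // ext_of_rat2M.
by congr ext_of_rat2; rewrite /qnorm; field; exact: N0.
Qed.

Lemma ext_of_rat2_adjoin (x : K) : in_ratr_adjoin g x ->
  exists a b, x = ext_of_rat2 a b.
Proof.
have poly P : exists a b, (map_poly ratr P).[g] = ext_of_rat2 a b.
  have -> : map_poly ratr P = map_poly rat_ext P.
    by apply: eq_map_poly => y; rewrite -(fmorph_eq_rat rat_ext).
  elim/poly_ind: P => [|P c [a [b IHP]]].
    by exists 0, 0; rewrite rmorph0 horner0 ext_of_rat2_0.
  have gE : g = ext_of_rat2 0 1.
    by rewrite /ext_of_rat2 rmorph0 rmorph1 mul1r add0r.
  have cE : rat_ext c = ext_of_rat2 c 0.
    by rewrite /ext_of_rat2 rmorph0 mul0r addr0.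
  have -> : map_poly rat_ext (P * 'X + c%:P) =
      map_poly rat_ext P * 'X + (rat_ext c)%:P.
    by rewrite rmorphD rmorphM /= map_polyX map_polyC.
  rewrite hornerMXaddC IHP cE [X in _ * X]gE.
  by rewrite ext_of_rat2M ext_of_rat2D; do 2!eexists.
move=> [P [Q [Q0 ->]]]; move: Q0.
have [a [b ->]] := poly P; have [c [d ->]] := poly Q.
exact: ext_of_rat2_div.
Qed.

Lemma ext_floor_rat (x0 x1 : rat) :
  exists (f0 f1 : rat) (k : nat) (z0 z1 : int),
  [/\ ext_floor g (ext_of_rat2 x0 x1) = ext_of_rat2 f0 f1,
      f0 * p%:R ^+ k = z0%:~R /\ f1 * p%:R ^+ k = z1%:~R,
      `|f0| <= p%:R / 2 /\ `|f1| <= p%:R / 2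
    & rat_norm p (x0 - f0) < 1 /\ rat_norm p (x1 - f1) < 1].
Proof.
have bound f k z : f * p%:R ^+ k = z%:~R -> (`|z| * 2 < p ^ k.+1)%N ->
    `|f| <= p%:R / 2 :> rat.
  move=> fz zlt; have q0 : 0 < p%:R ^+ k :> rat.
    by rewrite exprn_gt0 // ltr0n prime_gt0.
  rewrite -(ler_pM2r q0) -(gtr0_norm q0) -normrM fz (gtr0_norm q0).
  rewrite mulrAC -exprS.
  rewrite ler_pdivlMr // -intr_norm -natrX -[2]/(2%:R) -abszE -pmulrn.
  by rewrite -natrM ler_nat ltnW.
have [f0 [k0 [z0 [fl0 fz0 zlt0 nf0]]]] := padic_floor_rat p_pr x0 p_odd.
have [f1 [k1 [z1 [fl1 fz1 zlt1 nf1]]]] := padic_floor_rat p_pr x1 p_odd.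
(* The exponent [k0 + k1] clears both denominators at once. *)
exists f0, f1, (k0 + k1)%N, (z0 * p%:Z ^+ k1), (z1 * p%:Z ^+ k0); split=> //.
- rewrite /ext_floor; have [-> ->] := coord_ext_of_rat2 x0 x1.
  by rewrite fl0 fl1 /ext_of_rat2 /rat_ext /= mulr_algl.
- rewrite !rmorphM !rmorphXn /= -!pmulrn -fz0 -fz1 exprD mulrA; split=> //.
  by rewrite -!mulrA [_ ^+ k1 * _]mulrC.
- by split; [exact: bound fz0 zlt0 | exact: bound fz1 zlt1].
Qed.

Lemma finite_cf_stop (x : K) : x = ext_floor g x -> finite_cf g x.
Proof. by move=> xE; exists 0%N, x. Qed.

Lemma finite_cf_step (x : K) : x <> ext_floor g x ->
  finite_cf g (x - ext_floor g x)^-1 -> finite_cf g x.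
Proof.
move=> /eqP xN [n [y [yn yE]]]; exists n.+1, y; split=> //; rewrite -yn.
(* The complete quotients of [x] from index 1 on are those of its successor. *)
elim: n {yn} => [|n IHn]; first by rewrite /= (negPf xN).
by rewrite [LHS]/= -/(complete_quotient g x n.+1) IHn.
Qed.

Lemma rat_norm_mul2_le1 (a b c d : rat) :
    rat_norm p a <= 1 -> rat_norm p b <= 1 ->
    rat_norm p c <= 1 -> rat_norm p d <= 1 ->
  rat_norm p (a * c - b * d) <= 1 /\
  rat_norm p (a * d + b * c - e%:~R * b * d) <= 1.
Proof.
have leD x y : rat_norm p x <= 1 -> rat_norm p y <= 1 ->
    rat_norm p (x + y) <= 1.
  by move=> x1 y1; apply: le_trans (rat_normD p_pr x y) _; rewrite ge_max x1.
have leM x y : rat_norm p x <= 1 -> rat_norm p y <= 1 ->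
    rat_norm p (x * y) <= 1.
  by move=> x1 y1; rewrite rat_normM // mulr_ile1 ?rat_norm_ge0.
have leN x : rat_norm p x <= 1 -> rat_norm p (- x) <= 1 by rewrite rat_normN.
have e1 := rat_norm_int p_pr e; move=> a1 b1 c1 d1; split.
  exact: leD (leM _ _ a1 c1) (leN _ (leM _ _ b1 d1)).
exact: leD (leD _ _ (leM _ _ a1 d1) (leM _ _ b1 c1))
  (leN _ (leM _ _ (leM _ _ e1 b1) d1)).
Qed.

(** The last hypothesis is [x = v / (p w)] cleared of its denominator, and [n] bounds the decreasing
    quantity, turning the descent into an induction. *)
Lemma finite_cf_descent (n : nat) (x0 x1 : rat) (v0 v1 w0 w1 : int) :
    ext_of_rat2 w0%:~R w1%:~R != 0 ->
    10 * qnorm e w0 w1 + qnorm e v0 v1 < n%:Z ->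
    ext_of_rat2 x0 x1 * ext_of_rat2 (p%:R * w0%:~R) (p%:R * w1%:~R) =
      ext_of_rat2 v0%:~R v1%:~R ->
  finite_cf g (ext_of_rat2 x0 x1).
Proof.
have castE (q r : int) : (10 * q + r)%:~R = 10 * q%:~R + r%:~R :> rat.
  by rewrite rmorphD rmorphM.
elim: n x0 x1 v0 v1 w0 w1 => [|n IHn] x0 x1 v0 v1 w0 w1 w_neq0 lt_n xwv.
  move: lt_n; rewrite -(ltr_int rat) castE !qnorm_int.
  have := qnorm_ge0 e01 w0%:~R w1%:~R; have := qnorm_ge0 e01 v0%:~R v1%:~R; lra.
have p0 : p%:R != 0 :> rat by rewrite pnatr_eq0 -lt0n prime_gt0.
have [f0 [f1 [k [z0 [z1 [fl [fz0 fz1] [f0p f1p] [nf0 nf1]]]]]]] :=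
  ext_floor_rat x0 x1.
have [/finite_cf_stop //|xN] :=
  pselect (ext_of_rat2 x0 x1 = ext_floor g (ext_of_rat2 x0 x1)).
apply: finite_cf_step (xN) _; rewrite fl ext_of_rat2B.
have {xN} xf0 : ext_of_rat2 (x0 - f0) (x1 - f1) != 0.
  by rewrite -ext_of_rat2B subr_eq0 -fl; apply/eqP.
have [vE0 vE1] : v0%:~R = p%:R * (x0 * w0%:~R - x1 * w1%:~R) /\
    v1%:~R = p%:R * (x0 * w1%:~R + x1 * w0%:~R - e%:~R * x1 * w1%:~R).
  move/eqP: xwv; rewrite ext_of_rat2M -subr_eq0 ext_of_rat2B.
  move=> /eqP/ext_of_rat2_eq0[/eqP h0 /eqP h1]; move: h0 h1.
  by rewrite !subr_eq0 => /eqP<- /eqP<-; split; ring.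
(* The product [u = d w] is the next denominator. It is [p]-integral because [d] is, and rewriting
   it through [v] and [f] shows that [p^(k+2) u] is integral; hence [u] is integral. *)
pose d0 := (x0 - f0) / p%:R; pose d1 := (x1 - f1) / p%:R.
have [nu0 nu1] := rat_norm_mul2_le1 (rat_norm_divp p_pr nf0)
  (rat_norm_divp p_pr nf1) (rat_norm_int p_pr w0) (rat_norm_int p_pr w1).
rewrite -/d0 -/d1 in nu0 nu1.
have uE0 : d0 * w0%:~R - d1 * w1%:~R =
    v0%:~R / p%:R ^+ 2 - (f0 * w0%:~R - f1 * w1%:~R) / p%:R.
  by rewrite vE0 /d0 /d1; field.
have uE1 : d0 * w1%:~R + d1 * w0%:~R - e%:~R * d1 * w1%:~R = v1%:~R / p%:R ^+ 2
    - (f0 * w1%:~R + f1 * w0%:~R - e%:~R * f1 * w1%:~R) / p%:R.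
  by rewrite vE1 /d0 /d1; field.
have [u0 u0P] : exists u : int, d0 * w0%:~R - d1 * w1%:~R = u%:~R.
  apply: (@rat_norm_le1_int p p_pr _ (k + 2)
    (v0 * p%:Z ^+ k - p%:Z * (z0 * w0 - z1 * w1))) => //.
  rewrite uE0 !(rmorphB, rmorphM, rmorphXn) /= -fz0 -fz1 -pmulrn exprD.
  by field.
have [u1 u1P] : exists u : int,
    d0 * w1%:~R + d1 * w0%:~R - e%:~R * d1 * w1%:~R = u%:~R.
  apply: (@rat_norm_le1_int p p_pr _ (k + 2)
    (v1 * p%:Z ^+ k - p%:Z * (z0 * w1 + z1 * w0 - e * z1 * w1))) => //.
  rewrite uE1 !(rmorphD, rmorphN, rmorphM, rmorphXn) /= -fz0 -fz1 -pmulrn exprD.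
  by field.
have dw : ext_of_rat2 d0 d1 * ext_of_rat2 w0%:~R w1%:~R =
    ext_of_rat2 u0%:~R u1%:~R.
  by rewrite ext_of_rat2M u0P u1P.
have pE a b : ext_of_rat2 (p%:R * a) (p%:R * b) =
    rat_ext p%:R * ext_of_rat2 a b.
  by rewrite /ext_of_rat2 !rmorphM /=; ring.
have xfE : ext_of_rat2 (x0 - f0) (x1 - f1) = rat_ext p%:R * ext_of_rat2 d0 d1.
  by rewrite -pE /d0 /d1; congr ext_of_rat2; field.
have u_neq0 : ext_of_rat2 u0%:~R u1%:~R != 0.
  rewrite -dw mulf_neq0 //; move: xf0.
  by rewrite xfE mulf_eq0 negb_or => /andP[].
have [y0 [y1 yE]] := ext_of_rat2_div 1 0 xf0.
have one : ext_of_rat2 1 0 = 1.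
  by rewrite /ext_of_rat2 rmorph1 rmorph0 mul0r addr0.
move: yE; rewrite one div1r => yE; rewrite yE.
(* As [y = 1 / (p d)], one has [y (p u) = w]: the pair [(v, w)] is replaced by [(w, u)]. *)
apply: IHn u_neq0 _ _; last first.
  by rewrite -yE pE -dw (mulrA (rat_ext _)) -xfE mulKf.
have wgt0 : 0 < qnorm e w0%:~R w1%:~R :> rat.
  rewrite lt0r qnorm_ge0 // andbT; apply: contra_neq w_neq0.
  by move=> /(qnorm_eq0 e01)[-> ->]; rewrite ext_of_rat2_0.
suff : 10 * qnorm e u0 u1 + qnorm e w0 w1 < 10 * qnorm e w0 w1 + qnorm e v0 v1.
  by move: lt_n; rewrite -[n.+1]addn1 PoszD ltzD1 => le_n /lt_le_trans; apply.
rewrite -(ltr_int rat) !castE !qnorm_int -u0P -u1P uE0 uE1.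
by apply: qnorm_descent; rewrite // ler_nat.
Qed.

Lemma finite_cf_ext_of_rat2 (x0 x1 : rat) : finite_cf g (ext_of_rat2 x0 x1).
Proof.
pose c : int := denq x0 * denq x1.
have c0 : c != 0 by rewrite mulf_neq0 ?denq_eq0.
(* With [w = c] a common denominator, [v] must be [p c x]. *)
pose v0 := p%:Z * numq x0 * denq x1; pose v1 := p%:Z * numq x1 * denq x0.
pose m := 10 * qnorm e c 0 + qnorm e v0 v1.
apply: (@finite_cf_descent `|m|%N.+1 x0 x1 v0 v1 c 0).
- apply/eqP => /ext_of_rat2_eq0[/eqP]; by rewrite intr_eq0 (negPf c0).
- by rewrite -/m; move: (m) => k; lia.
rewrite ext_of_rat2M /v0 /v1 /c !rmorphM /= !numqE -!pmulrn.
by congr ext_of_rat2; ring.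
Qed.

End RationalSubfield.

Theorem proposition12 (p : nat) (p_pr : prime p)
    (K : fieldExtType (padic p_pr)) (gamma : K) :
  (p = 3 %[mod 4] /\ root ('X^2 + 1) gamma) \/
  (p = 5 %[mod 12] /\ root ('X^2 + 'X + 1) gamma) ->
  <<1; gamma>>%VS = {:K}%VS ->
  forall alpha : K, in_ratr_adjoin gamma alpha -> finite_cf gamma alpha.
Proof.
move=> p_gamma _ alpha alphaQ.
(* Both cases become [x^2 + e x + 1], with [e = 0] or [e = 1]. *)
have [e [p_e gE]] : exists e : int,
    (e = 0 /\ (p %% 4 = 3)%N \/ e = 1 /\ (p %% 12 = 5)%N) /\
    gamma ^+ 2 + e%:~R * gamma + 1 = 0.
  case: p_gamma => -[pm /rootP]; rewrite !hornerE => gE; [exists 0|exists 1].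
    by rewrite mul0r addr0; split=> //; left.
  by rewrite mul1r; split=> //; right.
have [a [b ->]] := ext_of_rat2_adjoin p_e gE alphaQ.
exact: finite_cf_ext_of_rat2 p_e gE a b.
Qed.
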